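(* Let $L\ge 2$, let $S=(d,N_1,\dots,N_{L-1},1)$ be a neural network architecture, and let $\Omega\subset\mathbb{R}^d$ be compact. Let $\varrho:\mathbb{R}\to\mathbb{R}$ be continuous but not a polynomial, and such that $\varrho$ is differentiable at some $x_0\in\mathbb{R}$ with $\varrho'(x_0)\neq 0$. Assume that $\mathcal{RNN}_\varrho^\Omega(S)$ is not dense in $C(\Omega)$ (with the supremum norm). Then there does not exist any $\varepsilon>0$ such that the closure $\overline{\mathcal{RNN}_\varrho^\Omega(S)}$ (taken in $C(\Omega)$) is $\varepsilon$-convex in $(C(\Omega),\|\cdot\|_{\sup})$.
   Context: A neural network with architecture $S=(N_0,N_1,\dots,N_L)$ (with $N_0=d$) is a family $\Phi=((A_\ell,b_\ell))_{\ell=1}^L$ with $A_\ell\in\mathbb{R}^{N_\ell\times N_{\ell-1}}$, $b_\ell\in\mathbb{R}^{N_\ell}$; $\mathcal{NN}(S)$ denotes the set of these. For $\varrho:\mathbb{R}\to\mathbb{R}$ and $\Omega\subset\mathbb{R}^d$, the realization $\mathrm{R}_\varrho^\Omega(\Phi):\Omega\to\mathbb{R}^{N_L}$ is $x\mapsto x_L$ with $x_0=x$, $x_\ell=\varrho(A_\ell x_{\ell-1}+b_\ell)$ for $1\le\ell\le L-1$ ($\varrho$ componentwise), $x_L=A_Lx_{L-1}+b_L$; and $\mathcal{RNN}_\varrho^\Omega(S)=\{\mathrm{R}_\varrho^\Omega(\Phi):\Phi\in\mathcal{NN}(S)\}$. For a subset $A$ of a normed space $\mathcal{Y}$, $\mathrm{co}(A)$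 is the convex hull, and $A$ is called $\varepsilon$-convex if $\mathrm{co}(A)\subset A+B_\varepsilon(0)$, where $B_\varepsilon(0)$ is the open $\varepsilon$-ball around $0$ in $\mathcal{Y}$. *)

(* Defs.v *)
From HB Require Import structures.
From mathcomp Require Import all_boot all_order all_algebra.
From mathcomp Require Import all_classical all_reals all_analysis.
Set Implicit Arguments. Unset Strict Implicit. Unset Printing Implicit Defensive.
Import Order.TTheory GRing.Theory Num.Theory.
Import numFieldNormedType.Exports.
Local Open Scope classical_set_scope.
Local Open Scope ring_scope.

Section NN.
Variable R : realType.

(* Parameters of the activated (hidden) layers of a network with input width
   n0 and hidden widths arch = [:: N_1; ...; N_{L-1}] : a list of pairs
   (A_l, b_l) with A_l : N_l x N_{l-1}, b_l : N_l. *)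
Fixpoint hidden_params (n0 : nat) (arch : seq nat) : Type :=
  match arch with
  | [::] => unit
  | n1 :: rest => ('M[R]_(n1, n0) * 'cV[R]_n1) * hidden_params n1 rest
  end.

Fixpoint hidden_real (rho : R -> R) (n0 : nat) (arch : seq nat) :
  hidden_params n0 arch -> 'cV[R]_n0 -> 'cV[R]_(last n0 arch) :=
  match arch return hidden_params n0 arch -> 'cV[R]_n0 -> 'cV[R]_(last n0 arch) with
  | [::] => fun _ x => x
  | n1 :: rest => fun Phi x =>
      @hidden_real rho n1 rest Phi.2 (map_mx rho (Phi.1.1 *m x + Phi.1.2))
  end.

Definition realization (rho : R -> R) (d : nat) (Ns : seq nat)
  (H : hidden_params d Ns) (AL : 'M[R]_(1, last d Ns)) (bL : 'cV[R]_1)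
  : 'cV[R]_d -> R :=
  fun x => (AL *m @hidden_real rho d Ns H x + bL) ord0 ord0.

(* RNN_rho(S) for S = (d, Ns, 1), as functions on R^d (restricted to Omega
   through the sup-distance below). *)
Definition RNN (rho : R -> R) (d : nat) (Ns : seq nat) : set ('cV[R]_d -> R) :=
  [set f | exists H AL bL, f = @realization rho d Ns H AL bL].

Definition supdist (d : nat) (Omega : set 'cV[R]_d) (f g : 'cV[R]_d -> R) : R :=
  sup [set `|f x - g x| | x in Omega].

(* C(Omega): functions continuous on Omega (identified when equal on Omega). *)
Definition CO (d : nat) (Omega : set 'cV[R]_d) : set ('cV[R]_d -> R) :=
  [set g | {within Omega, continuous g}].

Definition Cclosure (d : nat) (Omega : set 'cV[R]_d) (A : set ('cV[R]_d -> R))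
  : set ('cV[R]_d -> R) :=
  [set g | CO Omega g /\
     forall delta : R, 0 < delta ->
       exists f, A f /\ CO Omega f /\ supdist Omega f g < delta].

Definition Cdense (d : nat) (Omega : set 'cV[R]_d) (A : set ('cV[R]_d -> R)) :=
  forall g, CO Omega g -> Cclosure Omega A g.

(* eps-convexity in (C(Omega), ||.||_sup): co(A) is contained in A + B_eps(0);
   co(A) is the set of finite convex combinations of elements of A. *)
Definition eps_convex (d : nat) (Omega : set 'cV[R]_d) (eps : R)
  (A : set ('cV[R]_d -> R)) : Prop :=
  forall (n : nat) (lam : 'I_n -> R) (f : 'I_n -> 'cV[R]_d -> R),
    (forall i, 0 <= lam i) -> \sum_(i < n) lam i = 1 ->
    (forall i, A (f i)) ->
    exists a, A a /\ supdist Omega (fun x => \sum_(i < n) lam i * f i x) a < eps.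

End NN.

(* Main.v *)
Require Import Defs.
From HB Require Import structures.
From mathcomp Require Import all_boot all_order all_algebra.
From mathcomp Require Import all_classical all_reals all_analysis.
From mathcomp Require Import ring lra.
Import Order.TTheory GRing.Theory Num.Theory.
Import numFieldNormedType.Exports.
Local Open Scope classical_set_scope.
Local Open Scope ring_scope.

(** Let [V] be the uniform closure of the set of network realizations, which is
    stable under scaling. If it is [eps]-convex for one [eps], scaling makes it
    [eps]-convex for all [eps], so [V] is a closed linear subspace. Rescaling
    around a point where [rho' != 0] makes neurons nearly affine, so the deeper
    layers can transmit one neuron of the first layer and [V] contains every
    ridge function [rho (w.x + b)]. For a linear form [u], averaging and then
    differentiating in the dilation parameter shows that [V] contains
    [u ^+ n * (D_h^n rho) (w * u + b)], with [D_h] the forward difference. By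
    Frechet's theorem, some [D_h^n rho b] is nonzero for each [n] because [rho] is
    not a polynomial; taking [w = 0], [V] contains all powers of [u], hence
    [expR u]. Sums of exponentials of linear forms are an algebra separating
    points, so [V] is everything by Stone-Weierstrass: realizations are dense. *)

(** * Compactness and one-variable calculus *)

(** If [P K] failed, the sets [B] with [P] true of [K] minus [B] would form a proper filter; at a
    cluster point in [K], the local hypothesis puts the complement of a neighbourhood in that
    filter. *)
Lemma compact_induction (T : topologicalType) (K : set T) (P : set T -> Prop) :
  compact K -> P set0 -> (forall A B, P A -> P B -> P (A `|` B)) ->
  (forall A B, A `<=` B -> P B -> P A) ->
  (forall x, K x -> exists2 N, nbhs x N & P (N `&` K)) -> P K.
Proof.
move=> cK P0 PU PS Ploc; apply: contrapT => nPK.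
pose F : set_system T := [set B | P (K `\` B)].
have FF : ProperFilter F.
  apply: Build_ProperFilter_ex.
    move=> B FB; apply: contrapT => B0; apply: nPK.
    by apply: PS FB => x Kx; split => // Bx; apply: B0; exists x.
  split; rewrite /F /=.
  - by rewrite setDT.
  - by move=> A B PA PB; rewrite /= setDIr; exact: PU.
  - by move=> A B AB; apply: PS => x [Kx nB]; split => // /AB.
have FK : F K by rewrite /F /= setDv.
have [x [Kx clx]] := cK F FF FK.
have [N Nx PN] := Ploc x Kx.
have FN : F (~` N) by rewrite /F /= setDE setCK setIC.
by have [y []] := clx (~` N) N FN Nx.
Qed.

Lemma continuous_dist {R : realType} {f : R -> R} (cf : continuous f) (x e : R) :
  0 < e -> exists2 d, 0 < d & forall y, `|x - y| < d -> `|f x - f y| < e.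
Proof.
move=> e0; have /cvgrPdist_lt/(_ e e0) := cf x.
by move=> /nbhs_ballP[d /= d0 H]; exists d.
Qed.

(** Only [x] is confined to [[- M, M]]; [y] may leave the segment. *)
Lemma uniform_continuous_segment {R : realType} {f : R -> R} (M e : R) :
  continuous f -> 0 < e ->
  exists2 d, 0 < d & forall x y, `|x| <= M -> `|x - y| < d -> `|f x - f y| < e.
Proof.
move=> cf e0; pose K := [set` `[- M, M]] : set R.
suff [d d0 H] : exists2 d, 0 < d &
    forall x, K x -> forall y, `|x - y| < d -> `|f x - f y| < e.
  by exists d => // x y xM; apply: H; rewrite /K /= in_itv /= -ler_norml.
apply: (@compact_induction _ K (fun S => exists2 d, 0 < d &
    forall x, S x -> forall y, `|x - y| < d -> `|f x - f y| < e)).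
- exact: segment_compact.
- by exists 1.
- move=> A B [a a0 HA] [b b0 HB]; exists (Num.min a b); first by rewrite lt_min a0.
  by move=> x [/HA|/HB] H y; rewrite lt_min => /andP[? ?]; exact: H.
- by move=> A B AB [d d0 H]; exists d => // x /AB; exact: H.
move=> x _; have e2 : 0 < e / 2 by lra.
have [d d0 H] := continuous_dist cf x _ e2.
exists (ball x (d / 2)); first by apply: nbhsx_ballx; rewrite divr_gt0.
exists (d / 2) => [|y [xy _] z yz]; first by rewrite divr_gt0.
have xy' : `|x - y| < d / 2 by [].
have /H h1 : `|x - y| < d by lra.
have /H h2 : `|x - z| < d by have := ler_distD y x z; lra.
have := ler_distD (f x) (f y) (f z); rewrite (distrC (f y) (f x)); lra.
Qed.

Lemma compact_norm_bounded {R : realType} {T : topologicalType} (K : set T) (f : T -> R) :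
  compact K -> {within K, continuous f} -> exists C, forall x, K x -> `|f x| <= C.
Proof.
move=> cK cf; have /compact_bounded[M [_ HM]] := continuous_compact cf cK.
by exists (M + 1) => x Kx; apply: HM; [rewrite ltrDl|exists x].
Qed.

Lemma local_antiderivative {R : realType} {f : R -> R} (M : R) : continuous f ->
  exists F : R -> R, forall x : R, `|x| < M -> is_derive x (1 : R) F (f x).
Proof.
move=> cf.
exists (fun x => (\int[lebesgue_measure]_(t in [set` `[- M, x]]) f t)%R) => x.
rewrite ltr_norml => /andP[Mx xM].
have fi : lebesgue_measure.-integrable `[- M, M] (EFin \o f).
  apply: continuous_compact_integrable; first exact: segment_compact.
  exact: continuous_subspaceT.
have [D1 D2] := continuous_FTC1_closed xM fi Mx (cf x).
by rewrite -D2 derive1E; apply: DeriveDef.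
Qed.

Lemma mean_value {R : realType} {F f : R -> R} {M : R} (a b : R) :
  (forall x : R, `|x| < M -> is_derive x (1 : R) F (f x)) ->
  `|a| < M -> `|b| < M ->
  exists2 c, `|c - a| <= `|b - a| & F b - F a = f c * (b - a).
Proof.
move=> dF.
have H x y : x <= y -> `|x| < M -> `|y| < M ->
    exists2 c, x <= c <= y & F y - F x = f c * (y - x).
  move=> xy; rewrite !ltr_norml => /andP[? ?] /andP[? ?].
  have [||c] := @MVT_segment R F f x y xy; last by rewrite in_itv; exists c.
    by move=> z; rewrite in_itv /= => /andP[? ?]; apply: dF; rewrite ltr_norml; lra.
  apply/continuous_in_subspaceT => z; rewrite inE /= in_itv /= => /andP[? ?].
  have /dF/@ex_derive/derivable1_diffP : `|z| < M by rewrite ltr_norml; lra.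
  exact: differentiable_continuous.
move=> aM bM; have [ab|/ltW ba] := leP a b.
  have [c /andP[? ?] E] := H a b ab aM bM; exists c => //.
  by rewrite !ger0_norm; lra.
have [c /andP[? ?] E] := H b a ba bM aM; exists c.
  by rewrite !ler0_norm; lra.
by move: E; lra.
Qed.

(** * Closed subspaces and ridge functions *)

Definition uniform_closure {R : realType} {T : Type} (Om : set T)
    (V : set (T -> R)) : set (T -> R) :=
  [set g | forall e : R, 0 < e ->
    exists2 f, V f & forall x, Om x -> `|g x - f x| <= e].

Record closed_subspace {R : realType} {T : Type} (Om : set T)
    (V : set (T -> R)) : Prop := ClosedSubspace {
  subspace0 : V (fun=> 0);
  subspaceL : forall a f g, V f -> V g -> V (fun x => a * f x + g x);
  subspace_closed : uniform_closure Om V `<=` V }.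

Section ClosedSubspace.
Context {R : realType} {T : Type} {Om : set T} {V : set (T -> R)}
  (VS : closed_subspace Om V).

(** The approximation error is zero on [Om], so closedness makes membership in [V] insensitive to
    values off [Om]. *)
Lemma subspace_ext f g : V f -> (forall x, Om x -> f x = g x) -> V g.
Proof.
move=> Vf fg; apply: (subspace_closed _ _ VS) => e e0; exists f => // x /fg ->.
by rewrite subrr normr0 ltW.
Qed.

Lemma subspaceZ a f : V f -> V (fun x => a * f x).
Proof.
move=> Vf; apply: subspace_ext (subspaceL _ _ VS a _ _ Vf (subspace0 _ _ VS)) _.
by move=> x _; rewrite addr0.
Qed.

Lemma subspaceD f g : V f -> V g -> V (fun x => f x + g x).
Proof.
move=> Vf Vg; apply: subspace_ext (subspaceL _ _ VS 1 _ _ Vf Vg) _.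
by move=> x _; rewrite mul1r.
Qed.

Lemma subspace_sum n (F : nat -> T -> R) :
  (forall i, V (F i)) -> V (fun x => \sum_(0 <= i < n) F i x).
Proof.
move=> VF; elim: n => [|n IH].
  by apply: subspace_ext (subspace0 _ _ VS) _ => x _; rewrite big_geq.
apply: subspace_ext (subspaceD _ _ IH (VF n)) _ => x _.
by rewrite big_nat_recr.
Qed.

End ClosedSubspace.

(** * Finite differences of ridge functions *)

Definition fdiff {R : realType} (h : R) (f : R -> R) : R -> R :=
  fun t => f (t + h) - f t.

Lemma continuous_fdiff {R : realType} (h : R) {f : R -> R} :
  continuous f -> continuous (fdiff h f).
Proof.
move=> cf x; apply: continuousB; last exact: cf.
apply: (@continuous_comp _ _ _ (fun t => t + h)); last exact: cf.
by apply: continuousD; [exact: id|exact: cst_continuous].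
Qed.

(** On each subinterval the mean value theorem gives the increment of [F] through [f] at a nearby
    point; uniform continuity makes one [N] serve all [s]. *)
Lemma riemann_sum_antiderivative {R : realType} {F f : R -> R} {M : R} (h e : R) :
  continuous f -> (forall x : R, `|x| < M -> is_derive x (1 : R) F (f x)) ->
  0 < e -> exists N : nat, forall s, `|s| + `|h| < M ->
  `|F (s + h) - F s - \sum_(0 <= j < N) h / N%:R * f (s + j%:R * (h / N%:R))| <= e.
Proof.
move=> cf dF e0.
have e'0 : 0 < e / (`|h| + 1) by rewrite divr_gt0// ltr_wpDl.
have [d d0 fd] := uniform_continuous_segment M (e / (`|h| + 1)) cf e'0.
pose N := (Num.truncn (`|h| / d)).+1.
have hN : `|h / N%:R| < d.
  rewrite normf_div normr_nat ltr_pdivrMr ?ltr0n// mulrC -ltr_pdivrMr//.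
  exact: truncnS_gt.
exists N => s sM; pose a (j : nat) := s + j%:R * (h / N%:R).
have aM j : (j <= N)%N -> `|a j| < M.
  move=> jN; apply: le_lt_trans sM; apply: le_trans (ler_normD _ _) _.
  rewrite lerD2l normrM normr_nat normf_div normr_nat mulrCA ler_piMr//.
  by rewrite ler_pdivrMr ?ltr0n// mul1r ler_nat.
have -> : F (s + h) - F s = \sum_(0 <= j < N) (F (a j.+1) - F (a j)).
  rewrite telescope_sumr//; congr (F _ - F _); rewrite /a ?mul0r ?addr0//.
  by rewrite mulrC divfK// pnatr_eq0.
rewrite -sumrB; apply: le_trans (ler_norm_sum _ _ _) _.
apply: (@le_trans _ _ (\sum_(0 <= j < N) (`|h / N%:R| * (e / (`|h| + 1))))).
  apply: ler_sum_nat => j /andP[_ jN].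
  have [c ca ->] := mean_value (a j) (a j.+1) dF (aM _ (ltnW jN)) (aM _ jN).
  have E : a j.+1 - a j = h / N%:R by rewrite /a -natr1; ring.
  rewrite E in ca *; rewrite mulrC -mulrBr normrM ler_wpM2l// distrC ltW//.
  by apply: fd; [exact/ltW/aM/ltnW|rewrite distrC (le_lt_trans ca)].
rewrite sumr_const_nat subn0 normf_div normr_nat -[leLHS]mulr_natr.
rewrite mulrAC divfK ?pnatr_eq0// mulrCA ler_piMr ?(ltW e0)//.
by rewrite ler_pdivrMr ?ltr_wpDl// mul1r lerDl.
Qed.

(* Averaging over [t, t + h] replaces [f] by [F (t + h) - F t], with [F' = f];
   differentiating the result in the dilation parameter [w] produces the extra
   factor [u x]. *)
Lemma ridge_fdiff {R : realType} {T : Type} {Om : set T} {V : set (T -> R)}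
    (u : T -> R) (C : R) (f : R -> R) (k : nat) (h : R) :
  closed_subspace Om V -> (forall x, Om x -> `|u x| <= C) -> continuous f ->
  (forall w b, V (fun x => u x ^+ k * f (w * u x + b))) ->
  forall w b, V (fun x => u x ^+ k.+1 * fdiff h f (w * u x + b)).
Proof.
move=> VS uC cf Vf w b.
wlog C0 : C uC / 0 <= C.
  move=> H; apply: (H `|C|) => // x /uC; have := ler_norm C; lra.
(* Exceeds every argument met below: dilations up to [|w| + 1], offsets up to [|b| + |h|], and a
   further shift by [h]. *)
pose M := (`|w| + 1) * C + `|b| + 2 * `|h| + 1.
have [F dF] := local_antiderivative M cf.
have argM w' b' x : Om x -> `|w'| <= `|w| + 1 -> `|b'| <= `|b| + `|h| ->
    `|w' * u x + b'| + `|h| < M.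
  move=> Ox w'w b'b; have := ler_normD (w' * u x) b'; rewrite normrM.
  have := ler_pM (normr_ge0 w') (normr_ge0 (u x)) w'w (uC x Ox).
  rewrite /M; lra.
have ukC x : Om x -> `|u x ^+ k| <= C ^+ k.
  by move=> /uC; rewrite normrX; apply: lerXn2r; rewrite nnegrE.
have Ck0 : 0 <= C ^+ k by rewrite exprn_ge0.
(* A uniform limit of Riemann sums, each a combination of the given functions with shifted
   offsets. *)
have VF w' : `|w'| <= `|w| + 1 ->
    V (fun x => u x ^+ k * (F (w' * u x + b + h) - F (w' * u x + b))).
  move=> w'w; apply: (subspace_closed _ _ VS) => e e0.
  have e'0 : 0 < e / (C ^+ k + 1) by rewrite divr_gt0// ltr_wpDl.
  have [N HN] := riemann_sum_antiderivative h _ cf dF e'0.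
  exists (fun x => \sum_(0 <= j < N)
      h / N%:R * (u x ^+ k * f (w' * u x + (b + j%:R * (h / N%:R))))).
    by apply: (subspace_sum VS _ (fun j x => _)) => j; exact: (subspaceZ VS).
  move=> x Ox.
  have -> : \sum_(0 <= j < N)
      h / N%:R * (u x ^+ k * f (w' * u x + (b + j%:R * (h / N%:R)))) =
      u x ^+ k * \sum_(0 <= j < N)
      h / N%:R * f (w' * u x + b + j%:R * (h / N%:R)).
    by rewrite mulr_sumr; apply: eq_bigr => j _; rewrite mulrCA addrA.
  rewrite -mulrBr normrM.
  have bb : `|b| <= `|b| + `|h| by rewrite lerDl.
  apply: le_trans (ler_pM _ _ (ukC x Ox) (HN _ (argM w' b x Ox w'w bb))) _ => //.
  by rewrite mulrCA ler_piMr ?(ltW e0)// ler_pdivrMr ?ltr_wpDl// mul1r lerDl.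
apply: (subspace_closed _ _ VS) => e e0.
(* The final error is [u x ^+ k * u x * (r1 - r2)], with both remainders at most [e / D]. *)
pose D := C ^+ k * C * 2 + 1.
have D0 : 0 < D by rewrite ltr_wpDl// !mulr_ge0.
have e'0 : 0 < e / D by rewrite divr_gt0.
have [d d0 fd] := uniform_continuous_segment M _ cf e'0.
(* [eta <= 1] keeps [w + eta] in the range covered by [M]; [eta * C < d] keeps the displaced
   argument within the modulus of continuity. *)
pose eta := Num.min 1 (d / (C + 1)).
have eta0 : 0 < eta by rewrite lt_min ltr01 divr_gt0// ltr_wpDl.
have etaC : eta * C < d.
  have : eta * (C + 1) <= d by rewrite -ler_pdivlMr ?ltr_wpDl// ge_min lexx orbT.
  lra.
have eta1 : eta <= 1 by rewrite ge_min lexx.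
have wl : `|w| <= `|w| + 1 by rewrite lerDl.
have wr : `|w + eta| <= `|w| + 1.
  by apply: le_trans (ler_normD _ _) _; rewrite lerD2l ger0_norm// ltW.
exists (fun x => eta^-1 * (u x ^+ k * (F ((w + eta) * u x + b + h) - F ((w + eta) * u x + b)))
   + - eta^-1 * (u x ^+ k * (F (w * u x + b + h) - F (w * u x + b)))).
  by apply: (subspaceD VS _ _ (subspaceZ VS _ _ _) (subspaceZ VS _ _ _)); exact: VF.
move=> x Ox.
have step b' : `|b'| <= `|b| + `|h| ->
    exists2 r, `|r| <= e / D &
    F ((w + eta) * u x + b') - F (w * u x + b') = (f (w * u x + b') + r) * (eta * u x).
  move=> b'b; have h0 := normr_ge0 h.
  have a1 := argM _ _ x Ox wl b'b; have a2 := argM _ _ x Ox wr b'b.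
  have [||c cc ->] := mean_value (w * u x + b') ((w + eta) * u x + b') dF; [lra..|].
  have E : (w + eta) * u x + b' - (w * u x + b') = eta * u x by ring.
  rewrite E in cc *; exists (f c - f (w * u x + b')); last by rewrite subrKC.
  rewrite distrC ltW//; apply: fd; first lra.
  rewrite distrC (le_lt_trans cc)// (le_lt_trans _ etaC)// normrM (ger0_norm (ltW eta0)).
  by rewrite ler_pM2l// uC.
have [|r1 r1e E1] := step b; first by rewrite lerDl.
have [|r2 r2e E2] := step (b + h); first exact: ler_normD.
rewrite !addrA in E2.
have -> : u x ^+ k.+1 * fdiff h f (w * u x + b) -
  (eta^-1 * (u x ^+ k * (F ((w + eta) * u x + b + h) - F ((w + eta) * u x + b))) +
   - eta^-1 * (u x ^+ k * (F (w * u x + b + h) - F (w * u x + b)))) =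
   u x ^+ k * u x * (r1 - r2).
  have -> : F ((w + eta) * u x + b + h) = F (w * u x + b + h) +
     (f (w * u x + b + h) + r2) * (eta * u x) by lra.
  have -> : F ((w + eta) * u x + b) = F (w * u x + b) +
     (f (w * u x + b) + r1) * (eta * u x) by lra.
  by rewrite /fdiff exprS; field; rewrite gt_eqF.
rewrite !normrM.
apply: le_trans (ler_pM _ _ (ler_pM _ _ (ukC x Ox) (uC x Ox)) (_ : _ <= 2 * (e / D))) _ => //.
  by apply: le_trans (ler_normB _ _) _; lra.
by rewrite !mulrA ler_pdivrMr// mulrC ler_pM2l// /D lerDl.
Qed.

(** * Frechet's characterization of polynomials *)

(** Newton's forward formula: the coefficients of the difference sequence move up one index, [u 0]
    becomes the constant one, and Pascal's rule handles the binomials. *)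
Lemma newton_forward {R : numFieldType} (n : nat) (u : nat -> R) :
  (forall k, iter n (fun v k => v k.+1 - v k) u k = 0) ->
  exists c : nat -> R, forall k, u k = \sum_(i < n) c i * 'C(k, i)%:R.
Proof.
elim: n u => [|n IH] u Du0.
  by exists (fun=> 0) => k; rewrite big_ord0 -(Du0 k).
have [|c Hc] := IH (fun k => u k.+1 - u k) => [k|]; first by rewrite -iterSr Du0.
exists (fun i => if i is j.+1 then c j else u 0) => k.
rewrite big_ord_recl bin0 mulr1 /=; elim: k => [|k IHk].
  by rewrite big1 ?addr0// => i _; rewrite bin0n mulr0.
have -> : u k.+1 = u k + (u k.+1 - u k) by rewrite subrKC.
rewrite Hc IHk -addrA; congr (_ + _); rewrite -big_split; apply: eq_bigr => i _.
by rewrite /= binS natrD mulrDr.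
Qed.

Lemma binomial_poly {R : numFieldType} (i : nat) :
  exists p : {poly R}, forall k : nat, p.[k%:R] = 'C(k, i)%:R.
Proof.
suff [p Hp] : exists p : {poly R}, forall k : nat, p.[k%:R] = (k ^_ i)%:R.
  exists (i`!%:R^-1 *: p) => k; rewrite hornerZ Hp -bin_ffact natrM.
  by rewrite mulrC mulfK// pnatr_eq0 -lt0n fact_gt0.
elim: i => [|i [p Hp]]; first by exists 1 => k; rewrite hornerC.
exists (p * ('X - i%:R%:P)) => k; rewrite hornerM hornerXsubC Hp ffactnSr natrM.
(* For [k < i] the truncated subtraction is wrong in the field, but the falling factorial already
   vanishes. *)
have [ki|ik] := ltnP k i; first by rewrite ffact_small// !mul0r.
by rewrite natrB.
Qed.

Lemma finite_difference_poly {R : numFieldType} (n : nat) (u : nat -> R) :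
  (forall k, iter n (fun v k => v k.+1 - v k) u k = 0) ->
  exists p : {poly R}, forall k, u k = p.[k%:R].
Proof.
move=> /newton_forward[c Hc].
have [b Hb] := choice (@binomial_poly R).
exists (\sum_(i < n) c i *: b i) => k; rewrite Hc horner_sum.
by apply: eq_bigr => i _; rewrite hornerZ Hb.
Qed.

Lemma poly_eq0_nat {R : numFieldType} (p : {poly R}) :
  (forall k : nat, p.[k%:R] = 0) -> p = 0.
Proof.
move=> p0; apply: contrapT => /eqP pn0.
have : (size [seq k%:R : R | k <- iota 0 (size p)] < size p)%N.
  apply: max_poly_roots => //.
    by apply/allP => _ /mapP[k _ ->]; rewrite rootE p0.
  rewrite map_inj_uniq ?iota_uniq// => i j /eqP.
  by rewrite eqr_nat => /eqP.
by rewrite size_map size_iota ltnn.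
Qed.

Lemma iter_fdiff_progression {R : realType} (f : R -> R) (n : nat) (b h : R) (k : nat) :
  iter n (fun v k => v k.+1 - v k) (fun k : nat => f (b + k%:R * h)) k =
  iter n (fdiff h) f (b + k%:R * h).
Proof.
elim: n k => [//|n IH] k; rewrite !iterS !IH /fdiff.
by rewrite -natr1 mulrDl mul1r addrA.
Qed.

(* Polynomials interpolating [f] on [Z] and on [(1/m) Z] agree at the naturals,
   hence coincide; so a single polynomial interpolates [f] on [Q]. *)
Lemma frechet_polynomial {R : realType} (f : R -> R) (n : nat) :
  continuous f -> (forall h b, iter n (fdiff h) f b = 0) ->
  exists p : {poly R}, forall x, f x = p.[x].
Proof.
move=> cf f0.
have interp b h : exists p : {poly R}, forall k : nat, f (b + k%:R * h) = p.[k%:R].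
  by apply: (@finite_difference_poly _ n) => k; rewrite iter_fdiff_progression.
have [p Hp] := interp 0 1; exists p => x; apply: contrapT => /eqP fpx.
have fpQ (a m k : nat) : (0 < m)%N ->
    f (- (a%:R / m%:R) + k%:R / m%:R) = p.[- (a%:R / m%:R) + k%:R / m%:R].
  move=> m0; have [q Hq] := interp (- (a%:R / m%:R)) m%:R^-1.
  have mn0 : m%:R != 0 :> R by rewrite pnatr_eq0 -lt0n.
  (* The point of index [m * j + a] in this progression is the natural number [j], where [p] and [q]
     must agree. *)
  suff pq : p = q \Po (m%:R *: 'X + a%:R%:P).
    rewrite Hq pq horner_comp hornerD hornerZ hornerX hornerC; congr (_.[_]).
    by field.
  apply/eqP; rewrite -subr_eq0; apply/eqP/poly_eq0_nat => j.
  rewrite !hornerE horner_comp !hornerE -Hp -natrM -natrD -Hq.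
  rewrite natrD natrM; apply/eqP; rewrite subr_eq0; apply/eqP.
  by congr (f _); field.
have cg : continuous (fun y => f y - p.[y]).
  by move=> y; apply: continuousB; [exact: cf|exact: continuous_horner].
have e0 : 0 < `|f x - p.[x]| by rewrite normr_gt0 subr_eq0.
(* Within [d] of [x] the difference of [f] and [p] cannot vanish, yet it vanishes at grid points. *)
have [d d0 Hd] := continuous_dist cg x _ e0.
(* The mesh [1 / m] is below [d], and the grid starts at [- (a / m)], an integer left of [x]; [k]
   below indexes the last grid point not exceeding [x]. *)
pose m := (Num.truncn d^-1).+1; pose a := ((Num.truncn `|x|).+1 * m)%N.
have m0 : 0 < m%:R :> R by rewrite ltr0n.
have dm : m%:R^-1 < d by rewrite invf_plt ?posrE// truncnS_gt.
have ax : 0 <= m%:R * x + a%:R.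
  rewrite /a natrM mulrC -mulrDl mulr_ge0// ?ltW//.
  by have := truncnS_gt `|x|; have := ler_norm (- x); rewrite normrN; lra.
pose k := Num.truncn (m%:R * x + a%:R).
have /andP[k1 k2] : k%:R <= m%:R * x + a%:R < k.+1%:R by exact: truncn_itv.
have := Hd (- (a%:R / m%:R) + k%:R / m%:R); rewrite fpQ// subrr subr0 ltxx => H.
suff /H : `|x - (- (a%:R / m%:R) + k%:R / m%:R)| < d by [].
apply: le_lt_trans dm.
have -> : x - (- (a%:R / m%:R) + k%:R / m%:R) = (m%:R * x + a%:R - k%:R) / m%:R.
  by field; rewrite gt_eqF.
rewrite normf_div normr_nat ler_pdivrMr// mulVf ?gt_eqF//.
by rewrite -natr1 in k2; rewrite ger0_norm; lra.
Qed.

(** * Powers and exponentials in a closed subspace *)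

Lemma ridge_power {R : realType} {T : Type} {Om : set T} {V : set (T -> R)}
    (u : T -> R) (C : R) (f : R -> R) :
  closed_subspace Om V -> (forall x, Om x -> `|u x| <= C) -> continuous f ->
  ~ (exists p : {poly R}, forall x, f x = p.[x]) ->
  (forall w b, V (fun x => f (w * u x + b))) ->
  forall n, V (fun x => u x ^+ n).
Proof.
move=> VS uC cf fnp Vf n.
have [h [b fhb]] : exists h b, iter n (fdiff h) f b != 0.
  apply: contrapT => H; apply: fnp; apply: (@frechet_polynomial _ _ n cf) => h b.
  by apply: contrapT => /eqP fhb; apply: H; exists h, b.
have [_ Vn] : continuous (iter n (fdiff h) f) /\
    forall w b, V (fun x => u x ^+ n * iter n (fdiff h) f (w * u x + b)).
  elim: n {fhb} => [|n [cn Vn]].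
    split=> // w c; apply: subspace_ext VS _ _ (Vf w c) _ => x _.
    by rewrite expr0 mul1r.
  by split; [exact: (continuous_fdiff h cn)|exact: (ridge_fdiff _ _ _ _ h VS uC cn Vn)].
apply: subspace_ext VS _ _ (subspaceZ VS (iter n (fdiff h) f b)^-1 _ (Vn 0 b)) _.
by move=> x _; rewrite mul0r add0r mulrCA mulVf// mulr1.
Qed.

(** Tails of the exponential series at [u x] are dominated by the tail at [C], so the partial sums
    converge uniformly on [Om]. *)
Lemma ridge_exp {R : realType} {T : Type} {Om : set T} {V : set (T -> R)}
    (u : T -> R) (C : R) :
  closed_subspace Om V -> (forall x, Om x -> `|u x| <= C) ->
  (forall n, V (fun x => u x ^+ n)) -> V (fun x => expR (u x)).
Proof.
move=> VS uC Vu; apply: (subspace_closed _ _ VS) => e e0.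
have /cvgrPdist_lt/(_ e e0) := is_cvg_series_exp_coeff C.
move=> [N _ /(_ N (leqnn _)) HN].
exists (fun x => \sum_(0 <= i < N) i`!%:R^-1 * u x ^+ i).
  by apply: (subspace_sum VS _ (fun i x => _)) => i; exact: (subspaceZ VS).
move=> x Ox; have C0 : 0 <= C by apply: le_trans (uC x Ox).
have le_tail M : (N <= M)%N -> `|series (exp_coeff (u x)) M - series (exp_coeff (u x)) N| <=
    series (exp_coeff C) M - series (exp_coeff C) N.
  move=> NM; rewrite !sub_series_geq//; apply: le_trans (ler_norm_sum _ _ _) _.
  apply: ler_sum => i _; rewrite /exp_coeff /= normf_div normr_nat.
  rewrite ler_pM2r ?invr_gt0 ?ltr0n ?fact_gt0//.
  by rewrite normrX; apply: lerXn2r; rewrite ?nnegrE// uC.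
have -> : \sum_(0 <= i < N) i`!%:R^-1 * u x ^+ i = series (exp_coeff (u x)) N.
  by apply: eq_bigr => i _; rewrite mulrC.
apply: le_trans (_ : _ <= expR C - series (exp_coeff C) N) _; last first.
  by apply: le_trans (ler_norm _) _; exact: ltW.
have c1 : (fun M => `|series (exp_coeff (u x)) M - series (exp_coeff (u x)) N|) @ \oo
    --> `|expR (u x) - series (exp_coeff (u x)) N|.
  by apply: cvg_norm; apply: cvgB; [exact: is_cvg_series_exp_coeff|exact: cvg_cst].
have c2 : (fun M => series (exp_coeff C) M - series (exp_coeff C) N) @ \oo
    --> expR C - series (exp_coeff C) N.
  by apply: cvgB; [exact: is_cvg_series_exp_coeff|exact: cvg_cst].
by apply: (ler_cvg_to c1 c2); exists N.
Qed.

(** * The Stone-Weierstrass theorem *)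

Lemma within_continuousP {R : realType} {T : topologicalType} {K : set T} {f : T -> R} :
  {within K, continuous f} <->
  forall x, K x -> forall e, 0 < e -> \forall y \near within K (nbhs x), `|f x - f y| < e.
Proof.
split=> [/subspace_continuousP cf x Kx e e0|cf].
  by have /cvgrPdist_lt := cf x Kx; exact.
by apply/subspace_continuousP => x Kx; apply/cvgrPdist_lt => e e0; exact: cf.
Qed.

Lemma within_continuous_max {R : realType} {T : topologicalType} (K : set T) (f g : T -> R) :
  {within K, continuous f} -> {within K, continuous g} ->
  {within K, continuous (fun x => Num.max (f x) (g x))}.
Proof.
move=> /within_continuousP cf /within_continuousP cg; apply/within_continuousP.
move=> x Kx e e0; apply: filterS2 (cf x Kx e e0) (cg x Kx e e0) => y.
rewrite !ltr_norml => /andP[? ?] /andP[? ?].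
by rewrite !maxElt; case: (ltP (f x)) => ?; case: (ltP (f y)) => ?; apply/andP; split; lra.
Qed.

Lemma within_continuous_min {R : realType} {T : topologicalType} (K : set T) (f g : T -> R) :
  {within K, continuous f} -> {within K, continuous g} ->
  {within K, continuous (fun x => Num.min (f x) (g x))}.
Proof.
move=> /within_continuousP cf /within_continuousP cg; apply/within_continuousP.
move=> x Kx e e0; apply: filterS2 (cf x Kx e e0) (cg x Kx e e0) => y.
rewrite !ltr_norml => /andP[? ?] /andP[? ?].
by rewrite !minElt; case: (ltP (f x)) => ?; case: (ltP (f y)) => ?; apply/andP; split; lra.
Qed.

(** Two compactness arguments: for fixed [x], minima of interpolants at [x] and varying [y] give a
    function below [g + e] that equals [g] at [x]; maxima of these over [x] rise above [g - e]. *)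
Lemma kakutani_stone {R : realType} {T : topologicalType} (K : set T)
    (V : set (T -> R)) (g : T -> R) :
  compact K -> closed_subspace K V ->
  (forall f h, V f -> V h -> V (fun x => Num.max (f x) (h x))) ->
  (forall f h, V f -> V h -> V (fun x => Num.min (f x) (h x))) ->
  {within K, continuous g} ->
  (forall x y, K x -> K y ->
    exists f, [/\ V f, {within K, continuous f}, f x = g x & f y = g y]) ->
  V g.
Proof.
move=> cK VS Vmax Vmin cg interp; apply: (subspace_closed _ _ VS) => e e0.
have below x : K x -> exists f, [/\ V f, {within K, continuous f}, f x = g x &
    forall y, K y -> f y < g y + e].
  move=> Kx; apply: (@compact_induction _ K (fun S => exists f,
    [/\ V f, {within K, continuous f}, f x = g x & forall y, S y -> f y < g y + e])) => //.
  - by have [f [Vf cf fx _]] := interp x x Kx Kx; exists f.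
  - move=> A B [f [Vf cf fx fA]] [h [Vh ch hx hB]].
    exists (fun y => Num.min (f y) (h y)); split.
    + exact: Vmin.
    + exact: within_continuous_min.
    + by rewrite fx hx minxx.
    + by move=> y [/fA|/hB] fy; rewrite gt_min fy ?orbT.
  - by move=> A B AB [f [? ? ? fB]]; exists f; split=> // y /AB; exact: fB.
  (* Near [y], where [f] and [g] agree, each moves by less than [e / 2]. *)
  move=> y Ky; have [f [Vf cf fx fy]] := interp x y Kx Ky.
  have e2 : 0 < e / 2 by lra.
  have := filterI (within_continuousP.1 cf y Ky _ e2) (within_continuousP.1 cg y Ky _ e2).
  move=> N; exists [set z | K z -> `|f y - f z| < e / 2 /\ `|g y - g z| < e / 2]; first exact: N.
  exists f; split=> // z [+ Kz] => /(_ Kz); rewrite fy !ltr_norml.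
  by move=> [/andP[? ?] /andP[? ?]]; lra.
suff [f [Vf f1 f2]] : exists f, [/\ V f, forall y, K y -> f y < g y + e &
    forall y, K y -> g y - e < f y].
  exists f => // x Kx; have := f1 x Kx; have := f2 x Kx => ? ?.
  by rewrite ler_norml; lra.
(* The second induction starts, at the empty set, from some function below [g + e]; a point of [K]
   supplies it. *)
have [[x0 Kx0]|nK] := pselect (exists x, K x); last first.
  exists (fun=> 0); split; first exact: subspace0 VS.
    by move=> y Ky; exfalso; apply: nK; exists y.
  by move=> y Ky; exfalso; apply: nK; exists y.
apply: (@compact_induction _ K (fun S => exists f,
    [/\ V f, forall y, K y -> f y < g y + e & forall y, S y -> g y - e < f y])) => //.
- by have [f [Vf _ _ fe]] := below x0 Kx0; exists f.
- move=> A B [f [Vf f1 fA]] [h [Vh h1 hB]].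
  exists (fun y => Num.max (f y) (h y)); split; first exact: Vmax.
    by move=> y Ky; rewrite gt_max f1// h1.
  by move=> y [/fA|/hB] fy; rewrite lt_max fy ?orbT.
- by move=> A B AB [f [? ? fB]]; exists f; split=> // y /AB; exact: fB.
move=> y Ky; have [f [Vf cf fy f1]] := below y Ky.
have e2 : 0 < e / 2 by lra.
have := filterI (within_continuousP.1 cf y Ky _ e2) (within_continuousP.1 cg y Ky _ e2).
move=> N; exists [set z | K z -> `|f y - f z| < e / 2 /\ `|g y - g z| < e / 2]; first exact: N.
exists f; split=> // z [+ Kz] => /(_ Kz); rewrite fy !ltr_norml.
by move=> [/andP[? ?] /andP[? ?]]; lra.
Qed.

(* Polynomials in [t] increasing to [`|t|] on [[-1, 1]]. *)
Fixpoint abs_iter {R : realType} (n : nat) (t : R) : R :=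
  if n is m.+1 then abs_iter m t + (t ^+ 2 - abs_iter m t ^+ 2) / 2 else 0.

(** With [s] the absolute value and [q] the iterate, the error [r = s - q] becomes
    [r * (1 - (s + q) / 2)], at most [r * (1 - r / 2)]. This map increases on [[0, 1]] and sends
    [2 / N] below [2 / (N + 1)]. *)
Lemma abs_iter_bound {R : realType} (n : nat) (t : R) : `|t| <= 1 ->
  0 <= abs_iter n t <= `|t| /\ `|t| - abs_iter n t <= 2 / n.+2%:R.
Proof.
move=> t1; have t0 := normr_ge0 t.
elim: n => [|n [/andP[q0 qt] IH]] /=.
  by rewrite lexx t0 subr0 divff ?pnatr_eq0.
rewrite -(real_normK (num_real t)).
set s := `|t| in t1 t0 qt IH *; set q := abs_iter n t in q0 qt IH *.
have E : s - (q + (s ^+ 2 - q ^+ 2) / 2) = (s - q) * (1 - (s + q) / 2) by field.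
split; first by apply/andP; split; nra.
rewrite E; set r := s - q in IH *.
have n0 : 0 < n.+2%:R :> R by rewrite ltr0n.
apply: (@le_trans _ _ (r * (1 - r / 2))).
  by apply: ler_wpM2l; rewrite /r; lra.
have -> : n.+3%:R = n.+2%:R + 1 :> R by rewrite -natr1.
have N2 : 2 <= n.+2%:R :> R by rewrite ler_nat.
set N := n.+2%:R in IH n0 N2 *.
apply: (@le_trans _ _ (2 / N * (1 - 2 / N / 2))).
  have : 2 / N <= 1 by rewrite ler_pdivrMr// mul1r.
  have : 0 <= r by rewrite /r; lra.
  set a := 2 / N in IH *; nra.
have -> : 2 / N * (1 - 2 / N / 2) = 2 * (N - 1) / N ^+ 2 by field; rewrite gt_eqF.
rewrite ler_pdivrMr ?exprn_gt0// mulrAC ler_pdivlMr; last lra.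
by rewrite -subr_ge0 (_ : _ - _ = 2); [lra|ring].
Qed.

(** Once [f] is scaled into [[-1, 1]], the [abs_iter] are polynomials in it without constant term,
    so they stay in the algebra [V] and converge uniformly. *)
Lemma subalgebra_norm {R : realType} {T : Type} {K : set T} {V : set (T -> R)}
    (f : T -> R) (C : R) :
  closed_subspace K V -> (forall f g, V f -> V g -> V (fun x => f x * g x)) ->
  (forall x, K x -> `|f x| <= C) -> V f -> V (fun x => `|f x|).
Proof.
move=> VS VM fC Vf; pose D := `|C| + 1.
have D0 : 0 < D by rewrite /D ltr_wpDl.
have fD x : K x -> `|D^-1 * f x| <= 1.
  move=> Kx; rewrite normrM normfV (gtr0_norm D0) mulrC ler_pdivrMr// mul1r.
  by rewrite /D; have := fC x Kx; have := ler_norm C; lra.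
have Vq n : V (fun x => abs_iter n (D^-1 * f x)).
  elim: n => [|n IH] /=; first exact: subspace0 VS.
  apply: (subspace_ext VS (fun x => abs_iter n (D^-1 * f x) + 2^-1 *
    ((D^-1 * f x) * (D^-1 * f x) + -1 * (abs_iter n (D^-1 * f x) * abs_iter n (D^-1 * f x))))).
    apply: (subspaceD VS) => //; apply: (subspaceZ VS).
    apply: (subspaceD VS); last by apply: (subspaceZ VS); exact: VM.
    by apply: VM; exact: (subspaceZ VS).
  by move=> x _; field; rewrite gt_eqF.
apply: (subspace_closed _ _ VS) => e e0.
pose n := Num.truncn (2 * D / e).
have nD : 2 * D / e < n.+1%:R by exact: truncnS_gt.
exists (fun x => D * abs_iter n (D^-1 * f x)); first exact: (subspaceZ VS).
move=> x Kx; have [/andP[q0 q1] q2] := abs_iter_bound n _ (fD x Kx).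
have -> : `|f x| = D * `|D^-1 * f x|.
  by rewrite normrM normfV (gtr0_norm D0) mulrA divff ?mul1r// gt_eqF.
rewrite -mulrBr normrM (gtr0_norm D0) ger0_norm ?subr_ge0//.
apply: le_trans (ler_wpM2l (ltW D0) q2) _.
rewrite mulrCA mulrA ler_pdivrMr ?ltr0n// -ler_pdivrMl//.
by rewrite mulrC (le_trans (ltW nD))// ler_nat.
Qed.

(** Absolute values yield [max] and [min], and an affine function of a separating [f] takes any two
    prescribed values, so [kakutani_stone] applies. *)
Theorem stone_weierstrass {R : realType} {T : topologicalType} (K : set T)
    (V : set (T -> R)) (g : T -> R) :
  compact K -> closed_subspace K V ->
  (forall f g, V f -> V g -> V (fun x => f x * g x)) ->
  (forall f, V f -> exists C, forall x, K x -> `|f x| <= C) ->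
  V (fun=> 1) ->
  (forall x y, K x -> K y -> x <> y ->
    exists f, [/\ V f, {within K, continuous f} & f x <> f y]) ->
  {within K, continuous g} -> V g.
Proof.
move=> cK VS VM VB V1 sep cg.
have Vnorm f : V f -> V (fun x => `|f x|).
  by move=> Vf; have [C fC] := VB f Vf; exact: (subalgebra_norm f C VS VM fC Vf).
have VB' f h : V f -> V h -> V (fun x => f x - h x).
  move=> Vf Vh; apply: subspace_ext VS _ _ (subspaceL _ _ VS (-1) _ _ Vh Vf) _.
  by move=> x _; rewrite mulN1r addrC.
have Vcst c : V (fun=> c).
  by apply: subspace_ext VS _ _ (subspaceZ VS c _ V1) _ => x _; rewrite mulr1.
apply: (@kakutani_stone _ _ K V g) => //.
- move=> f h Vf Vh; apply: subspace_ext VS _ _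
    (subspaceZ VS 2^-1 _ (subspaceD VS _ _ (subspaceD VS _ _ Vf Vh) (Vnorm _ (VB' _ _ Vf Vh)))) _.
  by move=> x _; rewrite maxr_absE mulrC.
- move=> f h Vf Vh; apply: subspace_ext VS _ _
    (subspaceZ VS 2^-1 _ (VB' _ _ (subspaceD VS _ _ Vf Vh) (Vnorm _ (VB' _ _ Vf Vh)))) _.
  by move=> x _; rewrite minr_absE mulrC.
move=> x y Kx Ky; have [->|xy] := pselect (x = y).
  exists (fun=> g y); split=> //; apply: continuous_subspaceT => z; exact: cvg_cst.
have [f [Vf cf fxy]] := sep x y Kx Ky xy.
pose s := (g x - g y) / (f x - f y).
exists (fun z => s * f z + (g x - s * f x)); split.
- exact: (subspaceL _ _ VS).
- move/subspace_continuousP : cf => cf; apply/subspace_continuousP => z Kz.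
  by apply: cvgD; [apply: cvgM; [exact: cvg_cst|exact: cf]|exact: cvg_cst].
- by rewrite subrKC.
- by rewrite /s; field; rewrite subr_eq0; apply/eqP.
Qed.

(** * Realizations of networks *)

Lemma mx_continuous {R : realType} {T : topologicalType} {m n : nat}
    (f : T -> 'M[R]_(m, n)) :
  (forall i j, continuous (fun x => f x i j)) -> continuous f.
Proof.
move=> cf x A [P NP PA]; rewrite nbhs_simpl /=.
have : \forall y \near x, forall i j, P i j (f y i j).
  apply: filter_forall => i; apply: filter_forall => j.
  exact: cf (NP i j).
by apply: filterS => y Py; exact: PA.
Qed.

Lemma affine_continuous {R : realType} {m n : nat} (A : 'M[R]_(m, n))
    (b : 'cV[R]_m) (i : 'I_m) (j : 'I_1) :
  continuous (fun x : 'cV[R]_n => (A *m x + b) i j).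
Proof.
have -> : (fun x : 'cV[R]_n => (A *m x + b) i j) =
    (fun x => \sum_k (A i k * x k j) + b i j).
  by apply/funext => x; rewrite !mxE.
move=> x; apply: continuousD; last exact: cst_continuous.
move: x; apply: continuous_big => [|k _ x]; first exact: add_continuous.
by apply: continuousM; [exact: cst_continuous|exact: coord_continuous].
Qed.

Lemma linear_form_continuous {R : realType} {d : nat} (w : 'rV[R]_d) :
  continuous (fun x : 'cV[R]_d => (w *m x) ord0 ord0).
Proof.
by have := affine_continuous w 0 ord0 ord0; under eq_fun do rewrite addr0.
Qed.

Lemma hidden_real_continuous {R : realType} (rho : R -> R) (d : nat) (Ns : seq nat)
    (H : hidden_params R d Ns) :
  continuous rho -> continuous (hidden_real rho H).
Proof.
move=> crho; elim: Ns d H => [|n Ns IH] d H; first by move=> x; exact: cvg_id.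
move=> x; apply: (@continuous_comp _ _ _ (fun x => map_mx rho (H.1.1 *m x + H.1.2))
  (hidden_real rho H.2)); last exact: IH.
move: x; apply: mx_continuous => i j; under eq_fun do rewrite mxE.
by move=> x; apply: continuous_comp; [exact: affine_continuous|exact: crho].
Qed.

Lemma RNN_continuous {R : realType} (rho : R -> R) (d : nat) (Ns : seq nat) f :
  continuous rho -> @RNN R rho d Ns f -> continuous f.
Proof.
move=> crho [H [AL [bL ->]]] x; apply: (@continuous_comp _ _ _ (hidden_real rho H)
  (fun y => (AL *m y + bL) ord0 ord0)); first exact: hidden_real_continuous.
exact: affine_continuous.
Qed.

Lemma RNN_affine {R : realType} (rho : R -> R) (d : nat) (Ns : seq nat) (a c : R) f :
  @RNN R rho d Ns f -> @RNN R rho d Ns (fun x => a * f x + c).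
Proof.
move=> [H [AL [bL ->]]]; exists H, (a *: AL), (a *: bL + const_mx c).
apply/funext => x; rewrite /realization -scalemxAl addrA -scalerDr.
by rewrite !mxE.
Qed.

Lemma RNN_cons {R : realType} (rho : R -> R) (d n : nat) (Ns : seq nat)
    (A : 'M[R]_(n, d)) (b : 'cV[R]_n) f :
  @RNN R rho n Ns f ->
  @RNN R rho d (n :: Ns) (fun x => f (map_mx rho (A *m x + b))).
Proof. by move=> [H [AL [bL ->]]]; exists ((A, b), H), AL, bL. Qed.

(** One scale [h] serves all [t] up to [M]: the difference quotient at increment [h * t] has a small
    error, which is multiplied by the bounded [t]. *)
Lemma derivable_secant {R : realType} {rho : R -> R} {x0 : R} (M e : R) :
  derivable rho x0 1 -> 0 < e ->
  exists2 h, 0 < h & forall t, `|t| <= M ->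
    `|(rho (x0 + h * t) - rho x0) / h - derive1 rho x0 * t| <= e.
Proof.
move=> dr e0.
have M0 : 0 < `|M| + 1 by rewrite ltr_wpDl.
have e'0 : 0 < e / (`|M| + 1) by rewrite divr_gt0.
have := dr; rewrite /derivable -/(derive rho x0 1) => cv.
have /cvgrPdist_lt/(_ _ e'0) := cv.
rewrite derive1E => /nbhs_ballP[r /= r0 H].
have h0 : 0 < r / 2 / (`|M| + 1) by rewrite !divr_gt0.
exists (r / 2 / (`|M| + 1)) => // t tM; set h := _ / _ in h0 *.
have [->|t0] := eqVneq t 0.
  by rewrite !mulr0 addr0 !subrr mul0r subr0 normr0 ltW.
have ht0 : h * t != 0 by rewrite mulf_neq0// gt_eqF.
have tM' : `|t| <= `|M| + 1 by have := ler_norm M; lra.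
have htr : `|h * t| < r.
  rewrite normrM gtr0_norm//; apply: (@le_lt_trans _ _ (r / 2)); last lra.
  by rewrite /h mulrAC -mulrA ler_piMr ?ler_pdivrMr ?mul1r//; lra.
have /(H (h * t))/(_ ht0) /= : ball (0 : R) r (h * t).
  by rewrite /ball /= sub0r normrN.
rewrite /GRing.scale /= mulr1 (addrC _ x0) => /ltW K.
rewrite distrC.
have -> : derive rho x0 1 * t - (rho (x0 + h * t) - rho x0) / h =
  (derive rho x0 1 - (h * t)^-1 * (rho (x0 + h * t) - rho x0)) * t.
  by field; rewrite t0 gt_eqF.
rewrite normrM; apply: le_trans (ler_pM _ _ K tM') _ => //.
by rewrite divfK// gt_eqF.
Qed.

(* The neurons of a layer all compute the same value; since their input is rescaled
   to the vicinity of [x0], each layer is nearly affine and transmits it. *)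
Lemma RNN_coordinate {R : realType} (rho : R -> R) (x0 : R) (d : nat) (Ns : seq nat)
    (i : 'I_d) (M e : R) :
  derivable rho x0 1 -> derive1 rho x0 != 0 -> all (fun n => 0 < n)%N Ns -> 0 < e ->
  exists2 f, @RNN R rho d Ns f &
    forall x : 'cV[R]_d, `|x i ord0| <= M -> `|x i ord0 - f x| <= e.
Proof.
move=> dr r'0; elim: Ns d i M e => [|n Ns IH] d i M e.
  move=> _ e0; exists (fun x => x i ord0).
    exists tt, (delta_mx ord0 i), 0; apply/funext => x.
    by rewrite /realization addr0 -rowE mxE.
  by move=> x _; rewrite subrr normr0 ltW.
move=> /andP[n0 Nsp] e0; pose r' := derive1 rho x0.
(* Half of [e] goes to the secant error of this layer, later divided by [r']; the other half, [e3],
   goes to the deeper layers, divided by [h * r']. *)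
have e2 : 0 < e / 2 * `|r'| by rewrite mulr_gt0 ?normr_gt0//; lra.
have [h h0 Hh] := derivable_secant M _ dr e2.
have r'n0 : r' != 0 by [].
have hr : h * r' != 0 by rewrite mulf_neq0// gt_eqF.
have e3 : 0 < e / 2 * `|h * r'|.
  by rewrite mulr_gt0 ?normr_gt0//; lra.
(* The bound passed on covers the output of this layer: [rho x0] plus [h] times the linear part and
   its secant error. *)
have [f Rf Hf] := IH n (Ordinal n0)
  (`|rho x0| + h * (`|r'| * `|M| + e / 2 * `|r'|)) _ Nsp e3.
(* Every neuron computes [rho (x0 + h * x i ord0)]; the output layer then subtracts [rho x0] and
   divides by [h * r']. *)
have := RNN_cons rho d n Ns (\matrix_(k, l) (if l == i then h else 0)) (const_mx x0) f Rf.
move=> /(RNN_affine _ _ _ (h * r')^-1 (- rho x0 / (h * r'))) Rg.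
eexists; first exact: Rg.
move=> x xM /=.
set y := map_mx _ _.
have yE : y (Ordinal n0) ord0 = rho (x0 + h * x i ord0).
  rewrite !mxE addrC (bigD1 i)//= mxE eqxx big1 ?addr0// => j /negPf ji.
  by rewrite mxE ji mul0r.
have K := Hh _ xM.
have yM : `|y (Ordinal n0) ord0| <= `|rho x0| + h * (`|r'| * `|M| + e / 2 * `|r'|).
  have -> : y (Ordinal n0) ord0 = rho x0 + h * (r' * x i ord0 +
     ((rho (x0 + h * x i ord0) - rho x0) / h - r' * x i ord0)).
    by rewrite yE; field; rewrite gt_eqF.
  apply: le_trans (ler_normD _ _) _; rewrite lerD2l normrM gtr0_norm// ler_pM2l//.
  apply: le_trans (ler_normD _ _) _; apply: lerD => //.
  by rewrite normrM ler_wpM2l// (le_trans xM)// ler_norm.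
have := Hf y yM; rewrite yE => L.
have -> : x i ord0 - ((h * r')^-1 * f y + - rho x0 / (h * r')) =
  - ((rho (x0 + h * x i ord0) - rho x0) / h - r' * x i ord0) / r' +
  (rho (x0 + h * x i ord0) - f y) / (h * r').
  by field; rewrite r'n0 gt_eqF.
apply: le_trans (ler_normD _ _) _.
have -> : e = e / 2 + e / 2 by lra.
by rewrite !normf_div normrN; apply: lerD; rewrite ler_pdivrMr ?normr_gt0.
Qed.

Lemma RNN_ridge {R : realType} (rho : R -> R) (x0 : R) (d : nat) (Ns : seq nat)
    (Om : set 'cV[R]_d) (w : 'rV[R]_d) (b : R) :
  compact Om -> continuous rho -> derivable rho x0 1 -> derive1 rho x0 != 0 ->
  Ns != [::] -> all (fun n => 0 < n)%N Ns ->
  uniform_closure Om (@RNN R rho d Ns) (fun x => rho ((w *m x) ord0 ord0 + b)).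
Proof.
move=> cOm crho dr r'0; case: Ns => [//|n Ns] _ /andP[n0 Nsp] e e0.
(* Bounds the range on which the deeper layers must be close to the identity. *)
have [M HM] : exists M, forall x, Om x -> `|rho ((w *m x) ord0 ord0 + b)| <= M.
  have cf : continuous (fun x : 'cV[R]_d => rho ((w *m x) ord0 ord0 + b)).
    move=> x; apply: continuous_comp; last exact: crho.
    by apply: continuousD; [exact: linear_form_continuous|exact: cst_continuous].
  by apply: (compact_norm_bounded Om _ cOm); exact: continuous_subspaceT.
have [f Rf Hf] := RNN_coordinate rho x0 n Ns (Ordinal n0) M e dr r'0 Nsp e0.
have := RNN_cons rho d n Ns (\matrix_(k < n) w) (const_mx b) f Rf.
move=> Rg; eexists; first exact: Rg.
move=> x Ox /=; set y := map_mx _ _.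
have yE : y (Ordinal n0) ord0 = rho ((w *m x) ord0 ord0 + b).
  by rewrite !mxE; congr (rho (_ + _)); apply: eq_bigr => j _; rewrite mxE.
by rewrite -yE; apply: Hf; rewrite yE; exact: HM.
Qed.

(** * Density of ridge functions *)

Lemma uniform_closure_self {R : realType} {T : Type} (Om : set T) (W : set (T -> R)) :
  W `<=` uniform_closure Om W.
Proof. by move=> f Wf e e0; exists f => // x _; rewrite subrr normr0 ltW. Qed.

(** Combinations of elements of [W] are only asked to be limits of [W], which is the form that
    eps-convexity provides. *)
Lemma uniform_closure_subspace {R : realType} {T : Type} (Om : set T) (W : set (T -> R)) :
  W (fun=> 0) ->
  (forall a f g, W f -> W g -> uniform_closure Om W (fun x => a * f x + g x)) ->
  closed_subspace Om (uniform_closure Om W).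
Proof.
move=> W0 WL; split; first exact: uniform_closure_self.
- move=> a f g cf cg e e0.
  have a1 : 0 < `|a| + 1 by rewrite ltr_wpDl.
  have e1 : 0 < e / 3 / (`|a| + 1) by rewrite !divr_gt0.
  have e3 : 0 < e / 3 by rewrite divr_gt0.
  have [f1 Wf1 ff1] := cf _ e1; have [g1 Wg1 gg1] := cg _ e3.
  have [h Wh Hh] := WL a _ _ Wf1 Wg1 _ e3; exists h => // x Ox.
  have -> : a * f x + g x - h x =
    a * (f x - f1 x) + (g x - g1 x) + (a * f1 x + g1 x - h x) by ring.
  have -> : e = e / 3 + e / 3 + e / 3 by lra.
  apply: le_trans (ler_normD _ _) _; apply: lerD (Hh _ Ox).
  apply: le_trans (ler_normD _ _) _; apply: lerD (gg1 _ Ox).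
  rewrite normrM; apply: (@le_trans _ _ ((`|a| + 1) * (e / 3 / (`|a| + 1)))).
    by apply: ler_pM => //; [rewrite lerDl|exact: ff1].
  by rewrite mulrC divfK// gt_eqF.
move=> g cg e e0; have e2 : 0 < e / 2 by rewrite divr_gt0.
have [f cf gf] := cg _ e2; have [h Wh fh] := cf _ e2; exists h => // x Ox.
by have := ler_distD (f x) (g x) (h x); have := gf x Ox; have := fh x Ox; lra.
Qed.

Lemma uniform_closure_bounded {R : realType} {T : Type} (Om : set T) (W : set (T -> R)) :
  (forall f, W f -> exists C, forall x, Om x -> `|f x| <= C) ->
  forall f, uniform_closure Om W f -> exists C, forall x, Om x -> `|f x| <= C.
Proof.
move=> WB f cf; have [h Wh fh] := cf 1 ltr01; have [C HC] := WB h Wh.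
exists (C + 1) => x Ox; have := HC x Ox; have := fh x Ox.
by have := ler_normD (f x - h x) (h x); rewrite subrK; lra.
Qed.

Lemma uniform_closureM {R : realType} {T : Type} (Om : set T) (W : set (T -> R)) :
  (forall f, W f -> exists C, forall x, Om x -> `|f x| <= C) ->
  (forall f g, W f -> W g -> W (fun x => f x * g x)) ->
  forall f g, uniform_closure Om W f -> uniform_closure Om W g ->
    uniform_closure Om W (fun x => f x * g x).
Proof.
move=> WB WM f g cf cg e e0.
have [A fA] := uniform_closure_bounded Om W WB f cf.
have [B gB] := uniform_closure_bounded Om W WB g cg.
pose D := `|A| + `|B| + 1; have D0 : 0 < D by rewrite /D ltr_wpDl// addr_ge0.
(* [d <= 1] bounds [g1] by [|B| + 1], and [d * D <= e] absorbs both cross terms. *)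
pose d := Num.min 1 (e / D).
have d0 : 0 < d by rewrite lt_min ltr01 divr_gt0.
have d1 : d <= 1 by rewrite ge_min lexx.
have dD : d * D <= e by rewrite -ler_pdivlMr// ge_min lexx orbT.
have [f1 Wf1 ff1] := cf _ d0; have [g1 Wg1 gg1] := cg _ d0.
exists (fun x => f1 x * g1 x) => [|x Ox]; first exact: WM.
have -> : f x * g x - f1 x * g1 x = f x * (g x - g1 x) + (f x - f1 x) * g1 x by ring.
have g1B : `|g1 x| <= `|B| + 1.
  have := ler_distD (g x) (g1 x) 0; rewrite !subr0 (distrC (g1 x)).
  by have := gg1 x Ox; have := gB x Ox; have := ler_norm B; lra.
have fA' : `|f x| <= `|A| by apply: le_trans (fA x Ox) (ler_norm _).
apply: le_trans dD; apply: le_trans (ler_normD _ _) _; rewrite !normrM.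
have -> : d * D = `|A| * d + d * (`|B| + 1) by rewrite /D; ring.
by apply: lerD; apply: ler_pM => //; [exact: gg1|exact: ff1].
Qed.

(** Lists of coefficients and weights turn linear combinations into concatenation and products into
    [allpairs]. *)
Definition exp_sum {R : realType} {d : nat} (s : seq (R * 'rV[R]_d)) : 'cV[R]_d -> R :=
  fun x => \sum_(p <- s) p.1 * expR ((p.2 *m x) ord0 ord0).

Lemma exp_sumL {R : realType} {d : nat} (a : R) (s t : seq (R * 'rV[R]_d)) x :
  exp_sum ([seq (a * p.1, p.2) | p <- s] ++ t) x = a * exp_sum s x + exp_sum t x.
Proof.
rewrite /exp_sum big_cat big_map mulr_sumr; congr (_ + _).
by apply: eq_bigr => p _; rewrite mulrA.
Qed.

Lemma exp_sumM {R : realType} {d : nat} (s t : seq (R * 'rV[R]_d)) x :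
  exp_sum [seq (p.1 * q.1, p.2 + q.2) | p <- s, q <- t] x = exp_sum s x * exp_sum t x.
Proof.
rewrite /exp_sum big_allpairs_dep big_distrlr; apply: eq_bigr => p _; apply: eq_bigr => q _.
by rewrite /= mulmxDl mxE expRD mulrACA.
Qed.

Lemma exp_sum_continuous {R : realType} {d : nat} (s : seq (R * 'rV[R]_d)) :
  continuous (exp_sum s).
Proof.
rewrite /exp_sum; apply: continuous_big => [|p _ x]; first exact: add_continuous.
have ce : continuous (fun x : 'cV[R]_d => expR ((p.2 *m x) ord0 ord0)).
  by move=> y; apply: continuous_comp; [exact: linear_form_continuous|exact: continuous_expR].
by apply: continuousM (ce x); exact: cst_continuous.
Qed.

Lemma ridge_dense {R : realType} {d : nat} (Om : set 'cV[R]_d)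
    (V : set ('cV[R]_d -> R)) (rho : R -> R) :
  compact Om -> closed_subspace Om V -> continuous rho ->
  ~ (exists p : {poly R}, forall x, rho x = p.[x]) ->
  (forall (w : 'rV[R]_d) b, V (fun x => rho ((w *m x) ord0 ord0 + b))) ->
  forall g, {within Om, continuous g} -> V g.
Proof.
move=> cOm VS crho nprho Vrho g cg.
have Vexp (w : 'rV[R]_d) : V (fun x => expR ((w *m x) ord0 ord0)).
  pose u (x : 'cV[R]_d) := (w *m x) ord0 ord0.
  have [C uC] : exists C, forall x, Om x -> `|u x| <= C.
    apply: (compact_norm_bounded Om u cOm); apply: continuous_subspaceT.
    exact: (linear_form_continuous w).
  apply: (ridge_exp u C VS uC).
  apply: (ridge_power u C rho VS uC crho nprho) => a b.
  apply: subspace_ext VS _ _ (Vrho (a *: w) b) _ => x _.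
  by rewrite -scalemxAl mxE.
have VE s : V (exp_sum s).
  elim: s => [|p s IH].
    by apply: subspace_ext VS _ _ (subspace0 _ _ VS) _ => x _; rewrite /exp_sum big_nil.
  apply: subspace_ext VS _ _ (subspaceL _ _ VS p.1 _ _ (Vexp p.2) IH) _ => x _.
  by rewrite /exp_sum big_cons.
(* Stone-Weierstrass is applied to the closure of [E], which is an algebra, since products are not
   known to stay in [V]. *)
pose E := range (@exp_sum R d).
suff : uniform_closure Om E g.
  move=> Eg; apply: (subspace_closed _ _ VS) => e e0.
  by have [_ [s _ <-] Hs] := Eg e e0; exists (exp_sum s).
have EB f : E f -> exists C, forall x, Om x -> `|f x| <= C.
  move=> [s _ <-]; apply: (compact_norm_bounded _ _ cOm); apply: continuous_subspaceT.
  exact: exp_sum_continuous.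
have ES : closed_subspace Om (uniform_closure Om E).
  apply: uniform_closure_subspace.
    by exists [::] => //; apply/funext => x; rewrite /exp_sum big_nil.
  move=> a _ _ [s _ <-] [t _ <-]; apply: uniform_closure_self.
  by exists ([seq (a * p.1, p.2) | p <- s] ++ t) => //; apply/funext => x; rewrite exp_sumL.
have Eexp (w : 'rV[R]_d) : E (fun x => expR ((w *m x) ord0 ord0)).
  by exists [:: (1, w)] => //; apply/funext => x; rewrite /exp_sum big_seq1 mul1r.
apply: (stone_weierstrass Om (uniform_closure Om E) g cOm ES) => //.
- apply: uniform_closureM => // _ _ [s _ <-] [t _ <-].
  exists [seq (p.1 * q.1, p.2 + q.2) | p <- s, q <- t] => //.
  by apply/funext => x; rewrite exp_sumM.
- exact: uniform_closure_bounded.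
- apply: uniform_closure_self; have := Eexp 0.
  by under eq_fun do rewrite mul0mx mxE expR0.
move=> x y _ _ xy.
have [i xyi] : exists i, x i ord0 <> y i ord0.
  apply: contrapT => H; apply: xy; apply/colP => i; apply: contrapT => xyi.
  by apply: H; exists i.
pose w : 'rV[R]_d := delta_mx ord0 i.
exists (fun z => expR ((w *m z) ord0 ord0)); split.
- exact: uniform_closure_self.
- apply: continuous_subspaceT => z.
  by apply: continuous_comp; [exact: linear_form_continuous|exact: continuous_expR].
- by rewrite -!rowE !mxE => /expR_inj.
Qed.

(** * From eps-convexity to density *)

(** Compactness bounds both functions on [Om]; without an upper bound [sup] would take a default
    value. *)
Lemma dist_le_supdist {R : realType} {d : nat} (Om : set 'cV[R]_d) f g x :
  compact Om -> CO Om f -> CO Om g -> Om x -> `|f x - g x| <= supdist Om f g.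
Proof.
move=> cOm cf cg Ox; apply: ub_le_sup; last by exists x.
have [C HC] : exists C, forall y, Om y -> `|f y - g y| <= C.
  have [A fA] := compact_norm_bounded Om f cOm cf.
  have [B gB] := compact_norm_bounded Om g cOm cg.
  exists (A + B) => y Oy; apply: le_trans (ler_normB _ _) _.
  by apply: lerD; [exact: fA|exact: gB].
by exists C => _ [y Oy <-]; exact: HC.
Qed.

(** On an empty [Om] the [sup] is 0, which is where [0 <= e] enters. *)
Lemma supdist_le {R : realType} {d : nat} (Om : set 'cV[R]_d) f g e :
  0 <= e -> (forall x, Om x -> `|f x - g x| <= e) -> supdist Om f g <= e.
Proof.
move=> e0 fg; rewrite /supdist; set S := [set _ | _ in _].
have [->|S0] := eqVneq S set0; first by rewrite sup0.
by apply: ge_sup; [exact/set0P|move=> _ [x Ox <-]; exact: fg].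
Qed.

(* Averaging [t a f] and [t g] costs an error [eps] independent of [t], which
   becomes negligible after scaling back. *)
Lemma eps_convex_RNN_subspace {R : realType} {d : nat} (Ns : seq nat)
    (Om : set 'cV[R]_d) (rho : R -> R) (eps : R) :
  compact Om -> continuous rho -> (exists f, @RNN R rho d Ns f) ->
  0 < eps -> eps_convex Om eps (Cclosure Om (RNN rho Ns)) ->
  closed_subspace Om (uniform_closure Om (RNN rho Ns)).
Proof.
move=> cOm crho [f0 Rf0] eps0 conv.
have RC f : RNN rho Ns f -> CO Om f.
  by move=> /(RNN_continuous _ _ _ _ crho); exact: continuous_subspaceT.
have RCc f : RNN rho Ns f -> Cclosure Om (RNN rho Ns) f.
  move=> Rf; split=> [|e e0]; first exact: RC.
  exists f; split=> //; split; first exact: RC.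
  by apply: le_lt_trans e0; apply: supdist_le => // x _; rewrite subrr normr0.
have RZ a (f : 'cV[R]_d -> R) : RNN rho Ns f -> RNN rho Ns (fun x => a * f x).
  by move=> /(RNN_affine _ _ _ a 0); under eq_fun do rewrite addr0.
apply: uniform_closure_subspace.
  by have := RZ 0 f0 Rf0; under eq_fun do rewrite mul0r.
(* Chosen so that the final error [2 / t * (eps + eps)] equals [e]. *)
move=> a f g Rf Rg e e0; pose t := 4 * eps / e.
have t0 : 0 < t by rewrite divr_gt0// mulr_gt0.
have t2 : 0 < 2 / t by exact: divr_gt0.
pose F (i : 'I_2) := if i == ord0 then fun x => t * a * f x else fun x => t * g x.
have RF i : RNN rho Ns (F i) by rewrite /F; case: ifP => _; exact: RZ.
have [||i|h [[ch hcl] hF]] := conv 2%N (fun=> 2^-1) F.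
- by move=> i; rewrite invr_ge0.
- by rewrite !big_ord_recl big_ord0; lra.
- exact: RCc.
(* [h] lies only in the closure; replacing it by a realization [r] costs a second [eps]. *)
have [r [Rr [cr rh]]] := hcl _ eps0.
exists (fun x => 2 / t * r x) => [|x Ox]; first exact: RZ.
have sumE y : \sum_(i < 2) 2^-1 * F i y = t / 2 * (a * f y + g y).
  by rewrite !big_ord_recl big_ord0 /F /=; field.
have h1 : `|t / 2 * (a * f x + g x) - h x| <= eps.
  rewrite -sumE; apply: le_trans (ltW hF).
  apply: (dist_le_supdist Om (fun y => \sum_(i < 2) 2^-1 * F i y)) => //.
  apply: continuous_subspaceT; apply: continuous_big => [|i _ y].
    exact: add_continuous.
  by apply: continuousM (RNN_continuous _ _ _ _ crho (RF i) y); exact: cst_continuous.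
have h2 : `|r x - h x| <= eps by apply: le_trans (ltW rh); exact: dist_le_supdist.
have -> : a * f x + g x - 2 / t * r x =
    2 / t * (t / 2 * (a * f x + g x) - h x - (r x - h x)).
  by field; rewrite gt_eqF.
rewrite normrM gtr0_norm//.
apply: (@le_trans _ _ (2 / t * (eps + eps))).
  rewrite ler_pM2l//; apply: le_trans (ler_normB _ _) _.
  by apply: lerD.
by rewrite le_eqVlt; apply/orP; left; apply/eqP; rewrite /t; field; rewrite !gt_eqF.
Qed.

Theorem theorem2p2 (R : realType) (d : nat) (Ns : seq nat)
  (Omega : set 'cV[R]_d) (rho : R -> R) :
  (0 < d)%N ->
  Ns != [::] ->
  all (fun n => 0 < n)%N Ns ->
  compact Omega ->
  continuous rho ->
  ~ (exists p : {poly R}, forall x, rho x = p.[x]) ->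
  (exists x0 : R, derivable rho x0 1 /\ derive1 rho x0 != 0) ->
  ~ Cdense Omega (RNN rho Ns) ->
  ~ (exists eps : R, 0 < eps /\ eps_convex Omega eps (Cclosure Omega (RNN rho Ns))).
Proof.
move=> _ Ns0 Nsp cOm crho nprho [x0 [dr r'0]] ndense [eps [eps0 conv]].
have Vridge w b := RNN_ridge rho x0 d Ns Omega w b cOm crho dr r'0 Ns0 Nsp.
have VS : closed_subspace Omega (uniform_closure Omega (RNN rho Ns)).
  apply: eps_convex_RNN_subspace conv => //.
  (* Any network approximating a ridge function witnesses that realizations exist. *)
  by have [f Rf _] := Vridge 0 0 1 ltr01; exists f.
apply: ndense => g cg; split=> // e e0.
have e2 : 0 < e / 2 by rewrite divr_gt0.
have [f Rf gf] := ridge_dense _ _ _ cOm VS crho nprho Vridge g cg _ e2.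
exists f; split=> //; split.
  exact/continuous_subspaceT/(RNN_continuous _ _ _ _ crho Rf).
apply: (@le_lt_trans _ _ (e / 2)); last lra.
by apply: supdist_le => [|x Ox]; [exact: ltW|rewrite distrC gf].
Qed.
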